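(* Let $K$ be a field complete with respect to a nontrivial non-Archimedean absolute value. Let $A$ and $B$ be affinoid $K$-algebras that are integral domains, with fields of fractions $\mathcal{E}$ and $\mathcal{F}$ respectively. If $B$ is normal (integrally closed in $\mathcal{F}$), then every $K$-algebra homomorphism $f:\mathcal{E}\to\mathcal{F}$ satisfies $f(A)\subseteq B$.
   Context: Affinoid algebras: for $n\ge 1$ the Tate algebra is $$T_n=\Big\{\sum_{\alpha\in\mathbb{Z}_{\ge 0}^n}c_\alpha z_1^{\alpha_1}\cdots z_n^{\alpha_n}\in K[[z_1,\dots,z_n]] : c_\alpha\to 0 \text{ as } |\alpha|=\sum_i\alpha_i\to\infty\Big\},$$ and $T_0=K$. An affinoid $K$-algebra is a $K$-algebra isomorphic (as an abstract $K$-algebra) to a quotient $T_n/I$ for some $n$ and some ideal $I$. The homomorphism $f$ is only assumed to be a homomorphism of abstract $K$-algebras; no continuity is required. *)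

(* Defs.v *)
From HB Require Import structures.
From mathcomp Require Import all_boot all_order all_algebra.
From mathcomp Require Import generic_quotient ring_quotient fraction.
From mathcomp Require Import boolp reals.
From mathcomp Require Import mpoly.

Set Implicit Arguments.
Unset Strict Implicit.
Unset Printing Implicit Defensive.

Import Order.TTheory GRing.Theory Num.Theory.
Local Open Scope ring_scope.
Local Open Scope quotient_scope.

Notation "x %:F" := (@FracField.tofrac _ x) : ring_scope.

Section AbsoluteValue.
Variables (R : realType) (K : fieldType).

Record nonarch_absval := NonarchAbsval {
  absval :> K -> R;
  absval_ge0 : forall x, 0 <= absval x;
  absval_eq0 : forall x, absval x = 0 <-> x = 0;
  absvalM : {morph absval : x y / x * y};
  absvalD : forall x y, absval (x + y) <= Num.max (absval x) (absval y) }.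

Definition absval_nontrivial (v : nonarch_absval) : Prop :=
  exists x : K, x <> 0 /\ v x <> 1.

Definition absval_cauchy (v : nonarch_absval) (u : nat -> K) : Prop :=
  forall e : R, 0 < e ->
    exists N : nat, forall i j, (N <= i)%N -> (N <= j)%N -> v (u i - u j) < e.

Definition absval_cvg (v : nonarch_absval) (u : nat -> K) (l : K) : Prop :=
  forall e : R, 0 < e ->
    exists N : nat, forall i, (N <= i)%N -> v (u i - l) < e.

Definition absval_complete (v : nonarch_absval) : Prop :=
  forall u : nat -> K, absval_cauchy v u -> exists l, absval_cvg v u l.

Variable v : nonarch_absval.

Lemma absval0 : v 0 = 0. Proof. exact/absval_eq0. Qed.

Lemma absval1 : v 1 = 1.
Proof.
have v1 : v 1 != 0 by apply/eqP => /absval_eq0/eqP; rewrite oner_eq0.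
by apply: (mulfI v1); rewrite -absvalM !mulr1.
Qed.

Lemma absval_sum_le (I : Type) (r : seq I) (P : pred I) (F : I -> K) (e : R) :
  0 <= e -> (forall i, P i -> v (F i) <= e) -> v (\sum_(i <- r | P i) F i) <= e.
Proof.
move=> e0 Fe; elim/big_rec: _ => [|i x Pi xe]; first by rewrite absval0.
by apply: le_trans (absvalD _ _ _) _; rewrite ge_max Fe.
Qed.

End AbsoluteValue.

(* The formal power series ring K[[z_1, ..., z_n]]. The record wraps the family
   of coefficients so that it does not pick up a pointwise ring structure on
   functions. *)
Record fps (n : nat) (K : fieldType) := Fps { fcoef : 'X_{1..n} -> K }.

HB.instance Definition _ n K := gen_eqMixin (fps n K).
HB.instance Definition _ n K := gen_choiceMixin (fps n K).

Section PowerSeries.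
Variables (n : nat) (K : fieldType).
Implicit Types f g h : fps n K.

Lemma fpsP f g : fcoef f =1 fcoef g -> f = g.
Proof. by case: f g => [f] [g] /= /funext ->. Qed.

Definition fps0 : fps n K := Fps (fun=> 0).
Definition fps1 : fps n K := Fps (fun m => (m == 0%MM)%:R).
Definition fps_opp f : fps n K := Fps (fun m => - fcoef f m).
Definition fps_add f g : fps n K := Fps (fun m => fcoef f m + fcoef g m).
Definition fps_scale (c : K) f : fps n K := Fps (fun m => c * fcoef f m).
(* The degree bounds only serve to make the index type finite: they are implied
   by m = k.1 + k.2. *)
Definition fps_mul f g : fps n K := Fps (fun m =>
  \sum_(k : 'X_{1..n < (mdeg m).+1, (mdeg m).+1} | m == (k.1 + k.2)%MM)
     fcoef f k.1 * fcoef g k.2).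

Fact fps_addA : associative fps_add.
Proof. by move=> f g h; apply: fpsP => m; apply: addrA. Qed.
Fact fps_addC : commutative fps_add.
Proof. by move=> f g; apply: fpsP => m; apply: addrC. Qed.
Fact fps_add0 : left_id fps0 fps_add.
Proof. by move=> f; apply: fpsP => m; apply: add0r. Qed.
Fact fps_addN : left_inverse fps0 fps_opp fps_add.
Proof. by move=> f; apply: fpsP => m; apply: addNr. Qed.

HB.instance Definition _ :=
  GRing.isZmodule.Build (fps n K) fps_addA fps_addC fps_add0 fps_addN.

Definition fps_trunc (d : nat) f : {mpoly K[n]} :=
  \sum_(k : 'X_{1..n < d}) fcoef f k *: 'X_[k].

Lemma fps_truncE d f m : (mdeg m < d)%N -> (fps_trunc d f)@_m = fcoef f m.
Proof. by move=> lt_md; rewrite /fps_trunc mcoeff_mpoly. Qed.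

Lemma fps_mul_poly (p q : {mpoly K[n]}) d f g m :
  (forall k, (mdeg k < d)%N -> p@_k = fcoef f k) ->
  (forall k, (mdeg k < d)%N -> q@_k = fcoef g k) ->
  (mdeg m < d)%N -> (p * q)@_m = fcoef (fps_mul f g) m.
Proof.
move=> pf qg lt_md; rewrite mcoeffM /=; apply: eq_bigr => -[k1 k2] /= _.
by rewrite pf ?qg // (leq_trans (bmdeg _)).
Qed.

Fact fps_mulA : associative fps_mul.
Proof.
move=> f g h; apply: fpsP => m; pose d := (mdeg m).+1.
pose T := fps_trunc d; have TE f' k := @fps_truncE d f' k.
have TM f' g' k : (mdeg k < d)%N ->
  (T f' * T g')@_k = fcoef (fps_mul f' g') k.
  by move=> ltk; apply: (@fps_mul_poly _ _ d) => // j; apply: TE.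
transitivity ((T f * (T g * T h))@_m).
  symmetry; apply: (@fps_mul_poly _ _ d) => // k; [exact: TE | exact: TM].
rewrite mulrA; apply: (@fps_mul_poly _ _ d) => // k; [exact: TM | exact: TE].
Qed.

Fact fps_mulC : commutative fps_mul.
Proof.
move=> f g; apply: fpsP => m; pose d := (mdeg m).+1.
have TE f' k := @fps_truncE d f' k.
transitivity ((fps_trunc d f * fps_trunc d g)@_m).
  by symmetry; apply: (@fps_mul_poly _ _ d) => // k; apply: TE.
by rewrite mulrC; apply: (@fps_mul_poly _ _ d) => // k; apply: TE.
Qed.

Fact fps_mul1 : left_id fps1 fps_mul.
Proof.
move=> f; apply: fpsP => m; pose d := (mdeg m).+1.
transitivity ((1 * fps_trunc d f)@_m); last by rewrite mul1r fps_truncE.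
symmetry; apply: (@fps_mul_poly _ _ d) => // k; last exact: fps_truncE.
by rewrite mcoeff1 /=.
Qed.

Fact fps_mulDl : left_distributive fps_mul +%R.
Proof.
move=> f g h; apply: fpsP => m /=; rewrite -big_split /=.
by apply: eq_bigr => k _; rewrite mulrDl.
Qed.

Fact fps1_neq0 : fps1 != 0.
Proof.
apply/eqP => /(congr1 (fun f => fcoef f 0%MM)) /= /eqP.
by rewrite eqxx oner_eq0.
Qed.

HB.instance Definition _ := GRing.Zmodule_isComNzRing.Build (fps n K)
  fps_mulA fps_mulC fps_mul1 fps_mulDl fps1_neq0.

Fact fps_scaleA a b f : fps_scale a (fps_scale b f) = fps_scale (a * b) f.
Proof. by apply: fpsP => m; apply: mulrA. Qed.
Fact fps_scale1 : left_id 1 fps_scale.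
Proof. by move=> f; apply: fpsP => m; apply: mul1r. Qed.
Fact fps_scaleDr : right_distributive fps_scale +%R.
Proof. by move=> a f g; apply: fpsP => m; apply: mulrDr. Qed.
Fact fps_scaleDl f : {morph fps_scale^~ f : a b / a + b}.
Proof. by move=> a b; apply: fpsP => m; apply: mulrDl. Qed.

HB.instance Definition _ := GRing.Zmodule_isLmodule.Build K (fps n K)
  fps_scaleA fps_scale1 fps_scaleDr fps_scaleDl.

Fact fps_scaleAl (a : K) f g : a *: (f * g) = a *: f * g.
Proof.
apply: fpsP => m /=; rewrite mulr_sumr.
by apply: eq_bigr => k _; rewrite mulrA.
Qed.

HB.instance Definition _ := GRing.Lmodule_isLalgebra.Build K (fps n K)
  fps_scaleAl.
HB.instance Definition _ := GRing.Lalgebra_isComAlgebra.Build K (fps n K).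

End PowerSeries.

Section Tate.
Variables (R : realType) (K : fieldType) (v : nonarch_absval R K) (n : nat).

Definition restricted (f : fps n K) : Prop :=
  forall e : R, 0 < e ->
    exists N : nat, forall m, (N <= mdeg m)%N -> v (fcoef f m) < e.

Definition restricted_pred : {pred fps n K} := fun f => `[< restricted f >].

Lemma restricted_bounded f : restricted f ->
  exists2 B : R, 0 < B & forall m, v (fcoef f m) <= B.
Proof.
move=> /(_ 1 ltr01)[N fN].
exists (1 + \sum_(k : 'X_{1..n < N}) v (fcoef f k)).
  by rewrite ltr_pwDl // sumr_ge0 // => k _; apply: absval_ge0.
move=> m; have [leNm|ltmN] := leqP N (mdeg m).
  rewrite (le_trans (ltW (fN _ leNm))) // lerDl sumr_ge0 // => k _.
  exact: absval_ge0.
rewrite (bigD1 (BMultinom ltmN)) //= addrCA lerDl addr_ge0 //.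
by rewrite sumr_ge0 // => k _; apply: absval_ge0.
Qed.

Fact restricted_subalg : subalg_closed restricted_pred.
Proof.
split=> [|a f g|f g].
- apply/asboolP => e e0; exists 1%N => m; rewrite lt0n mdeg_eq0 => /negPf /=.
  by move=> ->; rewrite absval0.
- move=> /asboolP fr /asboolP gr; apply/asboolP => e e0.
  have a0 := absval_ge0 v a.
  have a1 : 0 < v a + 1 by rewrite ltr_wpDl.
  have [N1 fN] := fr (e / (v a + 1)) (divr_gt0 e0 a1).
  have [N2 gN] := gr e e0.
  exists (maxn N1 N2) => m; rewrite geq_max => /andP[/fN fm /gN gm] /=.
  apply: le_lt_trans (absvalD _ _ _) _; rewrite gt_max gm andbT absvalM.
  rewrite ltr_pdivlMr // in fm; apply: le_lt_trans fm.
  by rewrite mulrC ler_wpM2l ?absval_ge0 // lerDl.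
- move=> /asboolP fr /asboolP gr; apply/asboolP => e e0.
  have [Bf Bf0 fB] := restricted_bounded fr.
  have [Bg Bg0 gB] := restricted_bounded gr.
  have e2 : 0 < e / 2 by rewrite divr_gt0 // ltr0n.
  have [N1 fN] := fr (e / 2 / Bg) (divr_gt0 e2 Bg0).
  have [N2 gN] := gr (e / 2 / Bf) (divr_gt0 e2 Bf0).
  exists (N1 + N2)%N => m leNm.
  have lt_e2 : e / 2 < e by rewrite ltr_pdivrMr ?ltr0n // ltr_pMr // ltr1n.
  apply: le_lt_trans lt_e2; apply: absval_sum_le => [|[k1 k2] /= /eqP mk].
    exact: ltW.
  rewrite absvalM.
  have [le1|lt1] := leqP N1 (mdeg k1).
    have /ltW := fN _ le1; rewrite ler_pdivlMr //; apply: le_trans.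
    by rewrite ler_wpM2l ?absval_ge0.
  have le2 : (N2 <= mdeg k2)%N.
    have: (N1 + N2 <= mdeg k1 + mdeg k2)%N by rewrite -mdegD -mk.
    by rewrite leqNgt; apply: contraNT; rewrite -ltnNge => lt2; rewrite -addSn leq_add // ltnW.
  have /ltW := gN _ le2; rewrite ler_pdivlMr // mulrC; apply: le_trans.
  by rewrite ler_wpM2r ?absval_ge0.
Qed.

HB.instance Definition _ :=
  GRing.isSubalgClosed.Build K (fps n K) restricted_pred restricted_subalg.

Record tate := Tate { tate_fps :> fps n K; _ : tate_fps \in restricted_pred }.

HB.instance Definition _ := [isSub for tate_fps].
HB.instance Definition _ := [Choice of tate by <:].
HB.instance Definition _ := [SubChoice_isSubAlgebra of tate by <:].
HB.instance Definition _ := [SubNzRing_isSubComNzRing of tate by <:].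

End Tate.

Section QuotientAlgebra.
Variables (K : comNzRingType) (T : comAlgType K) (I : idealr T).
Implicit Types x y : {ideal_quot I}.

Definition quot_scale (c : K) x : {ideal_quot I} :=
  \pi_({ideal_quot I}) (c%:A) * x.

Fact quot_scaleA a b x : quot_scale a (quot_scale b x) = quot_scale (a * b) x.
Proof. by rewrite /quot_scale mulrA -rmorphM /= -scalerAl mul1r scalerA. Qed.
Fact quot_scale1 : left_id 1 quot_scale.
Proof. by move=> x; rewrite /quot_scale scale1r rmorph1 mul1r. Qed.
Fact quot_scaleDr : right_distributive quot_scale +%R.
Proof. by move=> a x y; apply: mulrDr. Qed.
Fact quot_scaleDl x : {morph quot_scale^~ x : a b / a + b}.
Proof. by move=> a b; rewrite /quot_scale scalerDl rmorphD mulrDl. Qed.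

HB.instance Definition _ := GRing.Zmodule_isLmodule.Build K {ideal_quot I}
  quot_scaleA quot_scale1 quot_scaleDr quot_scaleDl.

Fact quot_scaleAl (a : K) x y : a *: (x * y) = a *: x * y.
Proof. exact: mulrA. Qed.

HB.instance Definition _ := GRing.Lmodule_isLalgebra.Build K {ideal_quot I}
  quot_scaleAl.
HB.instance Definition _ := GRing.Lalgebra_isComAlgebra.Build K {ideal_quot I}.

End QuotientAlgebra.

(* An [idealr] is proper, so this only describes nonzero affinoid algebras;
   accordingly a [comAlgType] is never the zero ring. *)
Definition affinoid (R : realType) (K : fieldType) (v : nonarch_absval R K)
    (A : comAlgType K) : Prop :=
  exists (n : nat) (I : idealr (tate v n))
         (phi : {lrmorphism {ideal_quot I} -> A}), bijective phi.

#[short(type="idomainAlgType")]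
HB.structure Definition IDomainAlgebra (K : comNzRingType) :=
  {A of GRing.IntegralDomain A & GRing.ComUnitAlgebra K A}.

Section FractionAlgebra.
Variables (K : comNzRingType) (A : idomainAlgType K).
Implicit Types x y : {fraction A}.

Definition frac_scale (c : K) x : {fraction A} := (c%:A : A)%:F * x.

Fact frac_scaleA a b x : frac_scale a (frac_scale b x) = frac_scale (a * b) x.
Proof. by rewrite /frac_scale mulrA -rmorphM /= -scalerAl mul1r scalerA. Qed.
Fact frac_scale1 : left_id 1 frac_scale.
Proof. by move=> x; rewrite /frac_scale scale1r rmorph1 mul1r. Qed.
Fact frac_scaleDr : right_distributive frac_scale +%R.
Proof. by move=> a x y; apply: mulrDr. Qed.
Fact frac_scaleDl x : {morph frac_scale^~ x : a b / a + b}.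
Proof. by move=> a b; rewrite /frac_scale scalerDl rmorphD mulrDl. Qed.

HB.instance Definition _ := GRing.Zmodule_isLmodule.Build K {fraction A}
  frac_scaleA frac_scale1 frac_scaleDr frac_scaleDl.

Fact frac_scaleAl (a : K) x y : a *: (x * y) = a *: x * y.
Proof. exact: mulrA. Qed.

HB.instance Definition _ := GRing.Lmodule_isLalgebra.Build K {fraction A}
  frac_scaleAl.
HB.instance Definition _ := GRing.Lalgebra_isComAlgebra.Build K {fraction A}.

End FractionAlgebra.

Definition normal_domain (B : idomainType) : Prop :=
  forall x : {fraction B}, integralOver (@FracField.tofrac B) x ->
    exists b : B, x = b%:F.

(* Main.v *)
(** Let [l > 1] be an integer with [v l = 1] (one of 2 and 3 will do). For
    [a] in [A] and a small nonzero scalar [c], the element [1 + c a] lifts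
    to an element of a Tate algebra close to [1], hence has a compatible
    system of [l ^ k]-th roots in [A]. Their images [g_k] in [Frac B]
    satisfy [g_(k+1) ^ l = g_k]. Writing [g_0 = b / d], the elements [d g_k
    ^ (l ^ k - 1)] have their [l ^ k]-th power [d b ^ (l ^ k - 1)] in [B],
    so they lie in [B] by normality. As [B] is noetherian, one of them is a
    [B]-combination of the previous ones; dividing by [d] and expressing
    every [g_i] as a power of [g_N] gives a monic equation for [g_N] over
    [B]. Hence [g_N], and so [g_0 = 1 + c f(a)], lies in [B].

    Tate algebras are noetherian by a standard basis argument: the leading
    exponent of a series is the largest exponent of a coefficient of maximal
    absolute value. By Dickson's lemma finitely many elements of an ideal
    have leading exponents that generate all of them; division with
    remainder by these elements converges because their coefficients beyond
    the leading exponent are uniformly smaller than 1 in absolute value, and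
    the remainder of an element of the ideal vanishes. *)
Require Import Defs.
From mathcomp Require Import all_boot all_order all_algebra fraction reals.
From mathcomp Require Import boolp mpoly.
From mathcomp Require Import zify ring lra.

Set Implicit Arguments.
Unset Strict Implicit.
Unset Printing Implicit Defensive.

Import Order.TTheory GRing.Theory Num.Theory.

(** * Dickson's lemma *)

(** Jump repeatedly to a place where [u] is minimal on the remaining tail; minima of shrinking tails
    do not decrease. *)
Lemma nondecreasing_subseq (u : nat -> nat) :
  exists2 s : nat -> nat, {homo s : i j / i < j} &
    {homo u \o s : i j / i <= j}.
Proof.
have minP i : exists2 j, i <= j & forall k, i <= k -> u j <= u k.
  have ex : exists n, `[< exists2 j, i <= j & u j = n >].
    by exists (u i); apply/asboolP; exists i.
  have [_ /asboolP[j ij <-] jmin] := ex_minnP ex.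
  by exists j => // k ik; apply: jmin; apply/asboolP; exists k.
have [a aP] := choice (fun i => let: ex_intro2 j h1 h2 := minP i in
  ex_intro (fun j => i <= j /\ forall k, i <= k -> u j <= u k) j (conj h1 h2)).
pose s k := iter k (fun i => a i.+1) (a 0).
have sS k : s k < s k.+1 by have [] := aP (s k).+1.
have smono : {homo s : i j / i < j} by apply: homo_ltn => //; apply: ltn_trans.
exists s => //; apply: homo_leq => // [y x z|i]; first exact: leq_trans.
(* Each [s i] is the chosen minimum of a tail; for [i = 0] the tail is the whole sequence. *)
rewrite /=; have {1}-> : s i = if i is j.+1 then a (s j).+1 else a 0 by case: i.
case: i => [|i].
  by have [_ /(_ _ (leq0n _))] := aP 0; apply.
have [_] := aP (s i).+1; apply.
exact: ltn_trans (sS i) (sS i.+1).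
Qed.

(** Pass to a subsequence monotone in one coordinate after another; monotonicity already gained
    survives further refinement. *)
Lemma dickson_seq n (m : nat -> 'X_{1..n}) :
  exists i j, i < j /\ (m i <= m j)%MM.
Proof.
have sub k : exists2 s : nat -> nat, {homo s : i j / i < j} &
    forall l : 'I_n, l < k -> {homo (fun i => m (s i) l) : i j / i <= j}.
  elim: k => [|k [s smono sk]]; first by exists id.
  have [kn|nk] := ltnP k n; last first.
    by exists s => // l _; apply: sk; apply: leq_trans nk.
  have [t tmono tk] := nondecreasing_subseq (fun i => m (s i) (Ordinal kn)).
  exists (s \o t) => [i j ij|l]; first by apply/smono/tmono.
  rewrite ltnS leq_eqVlt => /predU1P[lk|lk] i j ij.
    have -> : l = Ordinal kn by exact: val_inj.
    exact: tk.
  have tle : {homo t : i j / i <= j}.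
    apply: homo_leq => // [y x z|k']; [exact: leq_trans | exact/ltnW/tmono].
  by apply: sk => //; apply: tle.
have [s smono sn] := sub n.
exists (s 0), (s 1); split; first exact: smono.
by apply/mnm_lepP => l; apply: sn.
Qed.

(** Otherwise one could pick forever an element of [P] above none of the earlier picks, against
    [dickson_seq]. *)
Lemma dickson n (P : 'X_{1..n} -> Prop) :
  exists2 s : seq 'X_{1..n}, {in s, forall m, P m} &
    forall m, P m -> has (fun k => (k <= m)%MM) s.
Proof.
apply: contrapT => noS.
have bad (s : seq 'X_{1..n}) : exists m, {in s, forall m, P m} ->
    P m /\ ~~ has (fun k => (k <= m)%MM) s.
  have [sP|nsP] := pselect {in s, forall m, P m}; last by exists 0%MM.
  apply: contrapT => nom; apply: noS; exists s => // m Pm.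
  by apply/negPn/negP => ns; apply: nom; exists m.
have [b bP] := choice bad.
pose s k := iter k (fun s => b s :: s) [::].
have sP k : {in s k, forall m, P m}.
  elim: k => [//|k IH] m; rewrite inE => /predU1P[->|/IH //].
  by case: (bP _ IH).
have [i [j [ij]]] := dickson_seq (b \o s); apply/negP.
have bi : b (s i) \in s j.
  elim: j ij => // j IH; rewrite ltnS leq_eqVlt inE => /predU1P[->|/IH ->].
    by rewrite eqxx.
  by rewrite orbT.
by have [_ /hasPn] := bP _ (sP j); apply.
Qed.

Local Open Scope ring_scope.

(** * Noetherian rings and root chains *)

Section Span.
Variables (A : comNzRingType) (x : nat -> A).
Implicit Types (a b : A) (N : nat).

Definition span N a : Prop := exists c : nat -> A, a = \sum_(i < N) c i * x i.

Lemma span0 N : span N 0.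
Proof. by exists (fun=> 0); rewrite big1 // => i _; rewrite mul0r. Qed.

Lemma spanD N a b : span N a -> span N b -> span N (a + b).
Proof.
move=> [c ->] [d ->]; exists (fun i => c i + d i).
by rewrite -big_split; apply: eq_bigr => i _; rewrite mulrDl.
Qed.

Lemma spanM N a b : span N b -> span N (a * b).
Proof.
move=> [c ->]; exists (fun i => a * c i).
by rewrite mulr_sumr; apply: eq_bigr => i _; rewrite mulrA.
Qed.

Lemma span_sum N (I : Type) (r : seq I) (P : pred I) (F : I -> A) :
  (forall i, P i -> span N (F i)) -> span N (\sum_(i <- r | P i) F i).
Proof.
by move=> FN; elim/big_rec: _ => [|i a /FN]; [exact: span0 | exact: spanD].
Qed.

Lemma spanS M N a : (N <= M)%N -> span N a -> span M a.
Proof.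
move=> NM [c ->]; exists (fun i => if (i < N)%N then c i else 0).
rewrite (big_ord_widen M (fun i => c i * x i) NM) big_mkcond /=.
by apply: eq_bigr => i _; case: ifP; rewrite ?mul0r.
Qed.

Lemma span_last N : span N.+1 (x N).
Proof.
exists (fun i => (i == N)%:R); rewrite big_ord_recr /= eqxx mul1r.
by rewrite big1 ?add0r // => i _; rewrite ltn_eqF // mul0r.
Qed.

End Span.

(** Ascending chain condition without ideals: in the chain generated by initial segments of [x],
    some step is not strict. *)
Definition seq_noetherian (A : comNzRingType) : Prop :=
  forall x : nat -> A, exists N, span x N (x N).

Lemma seq_noetherian_surj (A B : comNzRingType) (h : {rmorphism A -> B}) :
  (forall b, exists a, h a = b) -> seq_noetherian A -> seq_noetherian B.
Proof.
move=> surj noeth y; have [x xP] := choice (fun i => surj (y i)).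
have [N [c xN]] := noeth x; exists N, (h \o c).
rewrite -xP xN rmorph_sum; apply: eq_bigr => i _.
by rewrite rmorphM /= xP.
Qed.

Lemma frac_quot (B : idomainType) (x : {fraction B}) :
  exists2 d : B, d != 0 & exists b : B, x * d%:F = b%:F.
Proof.
elim/quotW: x => r; exists \d_r; first exact: denom_ratioP.
exists \n_r; rewrite -[in LHS](Ratio_numden r).
rewrite !piE /FracField.mulf !numden_Ratio ?oner_neq0 ?denom_ratioP ?mulr1 //.
apply/eqP; rewrite FracField.equivf_def.
by rewrite !numden_Ratio ?oner_neq0 ?denom_ratioP // mulr1 mulrC.
Qed.

Section RootChain.
Variable B : idomainType.
Hypothesis B_normal : normal_domain B.

Lemma normal_root (y : {fraction B}) (m : nat) (c : B) :
  (0 < m)%N -> y ^+ m = c%:F -> exists b : B, y = b%:F.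
Proof.
move=> m0 ym; apply: B_normal; exists ('X^m - c%:P); first exact: monicXnsubC.
by rewrite rootE rmorphB /= map_polyXn map_polyC !hornerE ym subrr.
Qed.

Lemma chain_pow (F : pzSemiRingType) (l : nat) (g : nat -> F) :
  (forall k, g k.+1 ^+ l = g k) ->
  forall i j, g (i + j)%N ^+ (l ^ j) = g i.
Proof.
move=> gl i; elim=> [|j IH]; first by rewrite addn0.
by rewrite expnS exprM addnS gl.
Qed.

Lemma root_chain_integral (l : nat) (g : nat -> {fraction B}) :
  seq_noetherian B -> (1 < l)%N -> (forall k, g k.+1 ^+ l = g k) ->
  exists b : B, g 0%N = b%:F.
Proof.
move=> noeth l1 gl; have gp := chain_pow gl.
have l0 k : (0 < l ^ k)%N by rewrite expn_gt0 (ltnW l1).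
have [d d0 [b gd]] := frac_quot (g 0%N).
(* The [l^k]-th power is [d^(l^k) g_0^(l^k-1) = d (d g_0)^(l^k-1)], and [d g_0 = b]. *)
have xP k : exists x : B, d%:F * g k ^+ (l ^ k).-1 = x%:F.
  apply: (@normal_root _ (l ^ k) (d * b ^+ (l ^ k).-1)) => //.
  rewrite exprMn -exprM mulnC exprM -[k in g k]add0n gp rmorphM rmorphXn /= -gd.
  by rewrite exprMn mulrC -[in X in _ * X](prednK (l0 k)) exprS mulrCA.
have [x xE] := choice xP.
have [N [c xN]] := noeth x.
have dF : d%:F != 0 :> {fraction B} by rewrite tofrac_eq0.
(* As [g_i = g_N^(l^(N-i))], also [g_i^(l^i-1) = g_N^(l^N - l^(N-i))]. So [xN] divided by [d] reads
   [g_N^(l^N-1) = S(g_N)]. *)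
pose S := \sum_(i < N) c i *: 'X^(l ^ N - l ^ (N - i))%N : {poly B}.
have [e gN] : exists e : B, g N = e%:F.
  apply: B_normal; exists ('X^((l ^ N).-1)%N - S).
    (* Since [i < N] gives [l^(N-i) >= 2], all exponents in [S] lie below [l^N - 1]. *)
    rewrite monicE lead_coefDl ?lead_coefXn // size_polyN size_polyXn ltnS.
    apply: leq_trans (size_sum _ _ _) _; apply/bigmax_leqP => i _.
    apply: leq_trans (size_scale_leq _ _) _; rewrite size_polyXn.
    have: (1 < l ^ (N - i))%N by rewrite -{1}(expn0 l) ltn_exp2l // subn_gt0.
    have: (l ^ (N - i) <= l ^ N)%N by rewrite leq_exp2l // leq_subr.
    lia.
  rewrite rootE rmorphB /= map_polyXn hornerD hornerN hornerXn subr_eq0.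
  apply/eqP/(mulfI dF); rewrite xE xN rmorph_sum /S rmorph_sum /= horner_sum.
  rewrite mulr_sumr; apply: eq_bigr => i _.
  rewrite rmorphM /= -xE map_polyZ map_polyXn hornerZ hornerXn mulrCA.
  congr (_ * (_ * _)).
  have iN : (i + (N - i))%N = N by rewrite subnKC // ltnW.
  rewrite -(gp i (N - i)%N) iN -exprM; congr (_ ^+ _).
  by rewrite -subn1 mulnBr muln1 -expnD addnC iN.
by exists (e ^+ (l ^ N)); rewrite rmorphXn /= -gN -(gp 0%N N).
Qed.

End RootChain.

(** * The Gauss norm *)

Section GaussNorm.
Variables (R : realType) (K : fieldType) (v : nonarch_absval R K) (n : nat).
Local Notation T := (tate v n).
Local Notation coef f m := (fcoef (tate_fps f) m).
Implicit Types (f g : T) (m : 'X_{1..n}) (e : R).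

Lemma absvalN x : v (- x) = v x.
Proof.
have v1 : v (-1) = 1.
  apply/eqP; rewrite -(@pexpr_eq1 _ _ 2) ?absval_ge0 //.
  by rewrite expr2 -absvalM mulrNN mulr1 absval1.
by rewrite -mulN1r absvalM v1 mul1r.
Qed.

Lemma absvalV x : v x^-1 = (v x)^-1.
Proof.
have [->|x0] := eqVneq x 0; first by rewrite invr0 absval0 invr0.
have vx0 : v x != 0 by apply/eqP => /absval_eq0/eqP; apply/negP.
by apply: (mulfI vx0); rewrite -absvalM !divff // absval1.
Qed.

Lemma absval_gt0 x : x != 0 -> 0 < v x.
Proof.
move=> x0; rewrite lt_def absval_ge0 andbT.
by apply/eqP => /absval_eq0/eqP; apply/negP.
Qed.

Lemma tateP f g : fcoef f =1 fcoef g -> f = g.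
Proof. by move=> fg; apply/val_inj/fpsP. Qed.

Lemma tcoef0 m : coef (0 : T) m = 0. Proof. by []. Qed.
Lemma tcoef1 m : coef (1 : T) m = (m == 0%MM)%:R. Proof. by []. Qed.
Lemma tcoefD f g m : coef (f + g) m = coef f m + coef g m. Proof. by []. Qed.
Lemma tcoefN f m : coef (- f) m = - coef f m. Proof. by []. Qed.
Lemma tcoefB f g m : coef (f - g) m = coef f m - coef g m. Proof. by []. Qed.
Lemma tcoefZ c f m : coef (c *: f) m = c * coef f m. Proof. by []. Qed.
Lemma tcoef_sum (I : Type) (r : seq I) (P : pred I) (F : I -> T) m :
  coef (\sum_(i <- r | P i) F i) m = \sum_(i <- r | P i) coef (F i) m.
Proof. by elim/big_rec2: _ => // i x y _ <-. Qed.

(** The Gauss norm enters only through upper bounds, so no supremum is formed. *)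
Definition gauss_le e f : Prop := forall m, v (coef f m) <= e.

Lemma gauss_le_ge0 e f : gauss_le e f -> 0 <= e.
Proof. by move/(_ 0%MM); apply: le_trans; apply: absval_ge0. Qed.

Lemma gauss_le_trans e e' f : e <= e' -> gauss_le e f -> gauss_le e' f.
Proof. by move=> ee' fe m; apply: le_trans (fe m) ee'. Qed.

Lemma gauss_le0 e : 0 <= e -> gauss_le e 0.
Proof. by move=> e0 m; rewrite tcoef0 absval0. Qed.

Lemma gauss_le1 : gauss_le 1 1.
Proof. by move=> m; rewrite tcoef1; case: eqP; rewrite ?absval1 ?absval0. Qed.

Lemma gauss_leD e f g : gauss_le e f -> gauss_le e g -> gauss_le e (f + g).
Proof.
by move=> fe ge m; apply: le_trans (absvalD _ _ _) _; rewrite ge_max fe ge.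
Qed.

Lemma gauss_leN e f : gauss_le e f -> gauss_le e (- f).
Proof. by move=> fe m; rewrite tcoefN absvalN. Qed.

Lemma gauss_leB e f g : gauss_le e f -> gauss_le e g -> gauss_le e (f - g).
Proof. by move=> fe ge; apply: gauss_leD => //; apply: gauss_leN. Qed.

Lemma gauss_leZ e c f : gauss_le e f -> gauss_le (v c * e) (c *: f).
Proof. by move=> fe m; rewrite tcoefZ absvalM ler_wpM2l ?absval_ge0. Qed.

Lemma gauss_le_sum e (I : Type) (r : seq I) (P : pred I) (F : I -> T) :
  0 <= e -> (forall i, P i -> gauss_le e (F i)) ->
  gauss_le e (\sum_(i <- r | P i) F i).
Proof.
move=> e0 Fe; elim/big_rec: _ => [|i x /Fe Pi xe]; first exact: gauss_le0.
exact: gauss_leD.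
Qed.

Lemma gauss_leM d e f g :
  gauss_le d f -> gauss_le e g -> gauss_le (d * e) (f * g).
Proof.
move=> fd ge m; have d0 := gauss_le_ge0 fd; have e0 := gauss_le_ge0 ge.
apply: absval_sum_le => [|k _]; first exact: mulr_ge0.
by rewrite absvalM ler_pM ?absval_ge0.
Qed.

Lemma gauss_bounded f : exists2 e, 0 < e & gauss_le e f.
Proof. by apply: restricted_bounded; case: f => f /= /asboolP. Qed.

Lemma tate_restricted f : restricted v f.
Proof. by case: f => f /= /asboolP. Qed.

Lemma geometric_lt (q C e : R) :
  0 <= q < 1 -> 0 < e -> exists k, C * q ^+ k < e.
Proof.
move=> /andP[q0 q1] e0.
have [C0|C0] := leP C 0.
  by exists 0%N; rewrite expr0 mulr1 (le_lt_trans C0).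
have [->|qn0] := eqVneq q 0; first by exists 1%N; rewrite expr1 mulr0.
have qp : 0 < q by rewrite lt_def qn0.
have h0 : 0 < q^-1 - 1 by rewrite subr_gt0 invf_gt1.
(* Archimedean choice: Bernoulli's inequality [1 + k (1/q - 1) <= (1/q)^k] then gives
   [C / e < (1/q)^k]. *)
pose k := Num.bound (C / e / (q^-1 - 1)).
exists k.
have kP : C / e / (q^-1 - 1) < k%:R.
  by apply: archi_boundP; rewrite ltW ?divr_gt0.
rewrite ltr_pdivrMr // in kP.
have : C / e < q^-1 ^+ k.
  apply: lt_le_trans kP _.
  have: forall j, j%:R * (q^-1 - 1) + 1 <= q^-1 ^+ j.
    elim=> [|j IH]; first by rewrite mul0r add0r expr0.
    have j0 : 0 <= j%:R * (q^-1 - 1) ^+ 2 by rewrite mulr_ge0 ?sqr_ge0.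
    rewrite exprS -natr1.
    apply: le_trans (ler_wpM2l _ IH); last by rewrite invr_ge0.
    nra.
  by move/(_ k); apply: le_trans; rewrite lerDl.
rewrite exprVn -[X in _ < X]mul1r ltr_pdivlMr ?exprn_gt0 // mulrAC.
by rewrite ltr_pdivrMr ?mul1r.
Qed.

Lemma gauss_le_eq0 (q C : R) f :
  0 <= q < 1 -> (forall k, gauss_le (C * q ^+ k) f) -> f = 0.
Proof.
move=> q01 fk; apply: tateP => m; apply/eqP/negPn/negP => /absval_gt0 fm.
have [k] := geometric_lt C q01 fm; apply/negP; rewrite -leNgt; exact: fk.
Qed.

Hypothesis v_complete : absval_complete v.

(** Limits are taken coefficientwise. The ultrametric tail bound is uniform in the exponent and
    passes to the limit, which is therefore again restricted. *)
Lemma tate_series (q C : R) (u : nat -> T) :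
  0 <= q < 1 -> 0 <= C -> (forall k, gauss_le (C * q ^+ k) (u k)) ->
  exists s : T, forall N, gauss_le (C * q ^+ N) (s - \sum_(k < N) u k).
Proof.
move=> q01 C0 uP; have [q0 q1] := andP q01.
pose S N := \sum_(k < N) u k.
have SB M N : (N <= M)%N -> gauss_le (C * q ^+ N) (S M - S N).
  move=> NM; rewrite /S -!(big_mkord xpredT u) (big_cat_nat (leq0n N) NM) /=.
  rewrite [X in gauss_le _ X]addrC addKr.
  rewrite big_nat; apply: gauss_le_sum => [|i /andP[Ni _]].
    by rewrite mulr_ge0 ?exprn_ge0.
  by apply: gauss_le_trans (uP i); rewrite ler_wpM2l // ler_wiXn2l // ltW.
have cvg m : exists l, absval_cvg v (fun N => coef (S N) m) l.
  apply: v_complete => e e0; have [N Ne] := geometric_lt C q01 e0.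
  exists N => i j Ni Nj; apply: le_lt_trans Ne.
  have -> : coef (S i) m - coef (S j) m =
      coef (S i - S N) m - coef (S j - S N) m.
    by rewrite !tcoefB opprB addrA subrK.
  by apply: le_trans (absvalD _ _ _) _; rewrite absvalN ge_max !SB.
have [l lP] := choice cvg.
(* Compare with the partial sum at [maxn M N], whose coefficient is [e]-close to the limit; [e] is
   arbitrary. *)
have lB N m : v (l m - coef (S N) m) <= C * q ^+ N.
  apply/ler_addgt0Pr => e e0; have [M ML] := lP m e e0.
  have Cq0 : 0 <= C * q ^+ N by rewrite mulr_ge0 ?exprn_ge0.
  have -> : l m - coef (S N) m = coef (S (maxn M N) - S N) m -
      (coef (S (maxn M N)) m - l m) by rewrite tcoefB; ring.
  apply: le_trans (absvalD _ _ _) _; rewrite absvalN ge_max.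
  rewrite (le_trans (SB _ _ (leq_maxr M N) m)) ?lerDl ?(ltW e0) //=.
  by rewrite ler_wpDl // ltW // ML // leq_maxl.
have sP : Fps l \in restricted_pred v (n := n).
  apply/asboolP => e e0; have [N Ne] := geometric_lt C q01 e0.
  have [M ML] := tate_restricted (S N) e0.
  exists M => m /ML Sm /=; rewrite -[l m](subrK (coef (S N) m)).
  apply: le_lt_trans (absvalD _ _ _) _; rewrite gt_max Sm andbT.
  exact: le_lt_trans (lB _ _) Ne.
by exists (Tate sP) => N m; rewrite tcoefB; apply: lB.
Qed.

(** Banach's fixed point argument on the ball of radius [q], with contraction factor [q] as well;
    the iterates from 0 are partial sums of a telescoping series. *)
Lemma gauss_contraction (q : R) (phi : T -> T) :
  0 <= q < 1 -> (forall y, gauss_le q y -> gauss_le q (phi y)) ->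
  (forall e y z, gauss_le q y -> gauss_le q z -> gauss_le e (y - z) ->
     gauss_le (q * e) (phi y - phi z)) ->
  exists2 y, gauss_le q y & phi y = y.
Proof.
move=> q01 phiq phic; have [q0 q1] := andP q01.
pose y k := iter k phi 0.
have yq k : gauss_le q (y k).
  by elim: k => [|k IH]; [exact: gauss_le0 | exact: phiq].
have yS k : gauss_le (q * q ^+ k) (y k.+1 - y k).
  elim: k => [|k IH]; first by rewrite expr0 mulr1; apply: gauss_leB.
  by rewrite exprS; apply: phic IH; apply: yq.
have [s sP] := tate_series q01 q0 yS.
have {}sP N : gauss_le (q * q ^+ N) (s - y N).
  have := sP N; rewrite -(big_mkord xpredT (fun k => y k.+1 - y k)).
  by rewrite telescope_sumr // subr0.
have sq : gauss_le q s by have := sP 0%N; rewrite expr0 mulr1 subr0.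
exists s => //; apply/eqP; rewrite -subr_eq0; apply/eqP.
apply: (gauss_le_eq0 (C := q) q01) => k.
have -> : phi s - s = (phi s - phi (y k)) - (s - y k.+1) :> T.
  by rewrite -[y k.+1]/(phi (y k)); ring.
apply: gauss_leB; last first.
  by apply: gauss_le_trans (sP _); rewrite ler_wpM2l // ler_wiXn2l // ltW.
apply: gauss_le_trans (phic _ _ _ sq (yq k) (sP k)).
by rewrite ler_piMl ?mulr_ge0 ?exprn_ge0 // ltW.
Qed.

(* [phi] is the simplified Newton step for (1 + y) ^+ l = 1 + x. *)
Lemma one_unit_root (l : nat) (q : R) (x : T) :
  v l%:R = 1 -> 0 <= q < 1 -> gauss_le q x ->
  exists2 y, gauss_le q y & (1 + y) ^+ l = 1 + x.
Proof.
move=> vl q01 xq; have [q0 q1] := andP q01.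
have l0 : (l%:R : K) != 0.
  apply/eqP => l0; move: vl; rewrite l0 absval0 => /eqP.
  by rewrite eq_sym oner_eq0.
pose phi y := y - l%:R^-1 *: ((1 + y) ^+ l - (1 + x)) : T.
have lZ e z : gauss_le e z -> gauss_le e (l%:R^-1 *: z).
  by move/(gauss_leZ (l%:R^-1)); rewrite absvalV vl invr1 mul1r.
have lK (z : T) : l%:R^-1 *: (z *+ l) = z.
  by rewrite -scaler_nat scalerA mulVf ?scale1r.
have phic e y z : gauss_le q y -> gauss_le q z -> gauss_le e (y - z) ->
    gauss_le (q * e) (phi y - phi z).
  move=> yq zq yze.
  (* Factor [(1+y)^l - (1+z)^l] by [y - z] and write [y - z] as [l^-1] times [l] copies of itself.
     Products of powers of [1 + y] and [1 + z] stay within [q] of 1. *)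
  have -> : phi y - phi z = l%:R^-1 *:
      (\sum_(i < l) (1 - (1 + y) ^+ (l.-1 - i) * (1 + z) ^+ i) * (y - z)).
    have -> : phi y - phi z =
        (y - z) - l%:R^-1 *: ((1 + y) ^+ l - (1 + z) ^+ l).
      by rewrite /phi !scalerBr; ring.
    rewrite subrXX [1 + y - _]addrC opprD addrACA addNr add0r [- z + y]addrC.
    rewrite -mulr_suml sumrB sumr_const card_ord [in RHS]mulrBl.
    rewrite [in RHS]scalerBr mulr_natl lK.
    by rewrite [in RHS]mulrC.
  apply/lZ/gauss_le_sum => [|i _].
    by rewrite mulr_ge0 ?(gauss_le_ge0 yze).
  apply: gauss_leM => //.
  have oneM a b : gauss_le q (1 - a) -> gauss_le q (1 - b) ->
      gauss_le q (1 - a * b).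
    move=> aq bq.
    have -> : 1 - a * b = (1 - a) + (1 - (1 - a)) * (1 - b) by ring.
    apply: gauss_leD => //; rewrite -[q]mul1r; apply: gauss_leM => //.
    by apply: gauss_leB (gauss_le1) (gauss_le_trans (ltW q1) aq).
  have oneX w j : gauss_le q w -> gauss_le q (1 - (1 + w) ^+ j).
    move=> wq; elim: j => [|j IH]; first by rewrite subrr; apply: gauss_le0.
    rewrite exprS; apply: oneM => //.
    by rewrite opprD addrA subrr sub0r; apply: gauss_leN.
  by apply: oneM; apply: oneX.
have [y yq|y yq phiy] := gauss_contraction q01 _ phic.
  (* [phi 0 = l^-1 x] lies in the ball, and [phi y] differs from it by at most [q * q]. *)
  have -> : phi y = (phi y - phi 0) + phi 0 by rewrite subrK.
  apply: gauss_leD.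
    apply: gauss_le_trans (phic q y 0 yq (gauss_le0 q0) _).
      by rewrite ler_piMl // ltW.
    by rewrite subr0.
  rewrite /phi sub0r addr0 expr1n opprD addrA subrr sub0r scalerN opprK.
  exact: lZ.
exists y => //; apply/eqP; rewrite -subr_eq0; apply/eqP.
move/eqP: phiy; rewrite -subr_eq0 /phi addrAC subrr sub0r oppr_eq0 => /eqP.
by move/(congr1 ( *:%R l%:R)); rewrite scalerA divff // scale1r scaler0.
Qed.

End GaussNorm.

(** * Division with remainder in Tate algebras *)

Section Division.
Variables (R : realType) (K : fieldType) (v : nonarch_absval R K) (n : nat).
Local Notation T := (tate v n).
Local Notation coef f m := (fcoef (tate_fps f) m).
Implicit Types (f g : T) (m l : 'X_{1..n}).

Fact tmonomial_subproof m :
  Fps (fun k => (k == m)%:R) \in restricted_pred v (n := n).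
Proof.
apply/asboolP => e e0; exists (mdeg m).+1 => k mk /=.
by case: eqP mk => [->|_ _]; rewrite ?ltnn ?absval0.
Qed.

Definition tmonomial m : T := Tate (tmonomial_subproof m).

Lemma gauss_le_tmonomial m : gauss_le 1 (tmonomial m).
Proof. by move=> k /=; case: eqP => _; rewrite ?absval1 ?absval0. Qed.

Lemma tcoefXM m g k : coef (tmonomial m * g) (m + k)%MM = coef g k.
Proof.
pose d := (mdeg (m + k)).+1.
rewrite -[LHS](@fps_mul_poly _ _ 'X_[m] (fps_trunc d g) d) //.
- by rewrite mulrC mcoeffMX fps_truncE // ltnS mdegD leq_addl.
- by move=> j _; rewrite mcoeffX eq_sym.
- by move=> j jd; rewrite fps_truncE.
Qed.

Lemma tcoefXM_eq0 m g k : ~~ (m <= k)%MM -> coef (tmonomial m * g) k = 0.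
Proof.
move=> mk; apply: big1 => -[k1 k2] /= /eqP kE.
case: eqP => [k1m|_]; last by rewrite mul0r.
by case/negP: mk; rewrite [X in (_ <= X)%MM]kE k1m lem_addr.
Qed.

Lemma tcoefZXM c m g k :
  coef (c *: tmonomial m * g) (m + k)%MM = c * coef g k.
Proof. by rewrite -(@scalerAl K (tate v n)) tcoefZ tcoefXM. Qed.

Lemma tcoefZXM_eq0 c m g k :
  ~~ (m <= k)%MM -> coef (c *: tmonomial m * g) k = 0.
Proof.
by move=> mk; rewrite -(@scalerAl K (tate v n)) tcoefZ tcoefXM_eq0 // mulr0.
Qed.

(** Bounded degree leaves finitely many exponents, so the total monomial order has a largest one in
    [P]. *)
Lemma order_max (P : pred 'X_{1..n}) (N : nat) m :
  (forall k, P k -> (mdeg k < N)%N) -> P m ->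
  exists2 l, P l & forall k, (l < k)%O -> ~~ P k.
Proof.
move=> PN Pm; pose m0 := BMultinom (PN _ Pm).
case: (@arg_maxP _ _ 'X_{1..n < N} m0 (fun i => P i)
  (fun i => i : 'X_{1..n}) Pm).
move=> l Pl lmax; exists (l : 'X_{1..n}) => // k lk; apply/negP => Pk.
by have := lmax (BMultinom (PN _ Pk)) Pk; rewrite /= leNgt lk.
Qed.

Lemma large_coefs_finite (e : R) f :
  0 < e -> exists N, forall k, e <= v (coef f k) -> (mdeg k < N)%N.
Proof.
move=> /(tate_restricted f)[N Ne]; exists N => k.
by rewrite leNgt ltnNge; apply: contra => /Ne.
Qed.

(** Coefficients tend to 0, so only finitely many compete with a given nonzero one. *)
Lemma gauss_norm_attained f :
  f != 0 -> exists2 m, coef f m != 0 & gauss_le (v (coef f m)) f.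
Proof.
move=> f0; have [k0 fk0] : exists k, coef f k != 0.
  apply: contrapT => nok; move/eqP: f0; apply; apply: tateP => k.
  by apply/eqP/negPn/negP => fk; apply: nok; exists k.
have [N NP] := large_coefs_finite f (absval_gt0 v fk0).
pose m0 := BMultinom (NP k0 (lexx _)).
case: (@arg_maxP _ _ 'X_{1..n < N} m0 xpredT (fun i => v (coef f i)) isT).
move=> m _ mmax; have m0m := mmax m0 isT.
exists (m : 'X_{1..n}).
  by apply/eqP => fm; move: m0m; rewrite /= fm absval0 leNgt absval_gt0.
move=> k; have [/NP kN|/ltW kN] := leP (v (coef f k0)) (v (coef f k)).
  exact: (mmax (BMultinom kN) isT).
exact: le_trans kN m0m.
Qed.

(** Normalised leading exponent: the Gauss norm is 1 and [m] is the largest exponent attaining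
    it. *)
Definition monic_at f m : Prop :=
  [/\ coef f m = 1, gauss_le 1 f &
      forall k, (m < k)%O -> v (coef f k) < 1].

Lemma monic_scaling f : f != 0 -> exists c m, monic_at (c *: f) m.
Proof.
move=> /gauss_norm_attained[m0 fm0 m0max].
have [N NP] := large_coefs_finite f (absval_gt0 v fm0).
have [m /eqP mE mmax] : exists2 m, v (coef f m) == v (coef f m0) &
    forall k, (m < k)%O -> v (coef f k) != v (coef f m0).
  apply: (@order_max (fun k => v (coef f k) == v (coef f m0)) N m0) => //.
  by move=> k /eqP E; apply: NP; rewrite E.
have fm : coef f m != 0.
  apply: contraNneq fm0 => fm; apply/eqP/(absval_eq0 v).
  by rewrite -mE fm absval0.
exists (coef f m)^-1, m; split=> [|k|k mk]; rewrite tcoefZ ?mulVf // absvalM.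
  by rewrite absvalV mulrC ler_pdivrMr ?absval_gt0 // mul1r mE.
rewrite absvalV mulrC ltr_pdivrMr ?absval_gt0 // mul1r lt_neqAle mE m0max.
by rewrite mmax.
Qed.

(** Only finitely many coefficients reach 1/2, which makes the strict bound by 1 uniform. *)
Lemma monic_gap f m : monic_at f m ->
  exists2 e : R, 0 < e < 1 & forall k, (m < k)%O -> v (coef f k) <= e.
Proof.
move=> [_ _ fm].
have h : 0 < (2^-1 : R) < 1 by rewrite invr_gt0 invf_lt1 ltr0n ?ltr1n.
have [N NP] := large_coefs_finite f (proj1 (andP h)).
pose e := \big[Num.max/2^-1]_(k : 'X_{1..n < N} | (m < k)%O) v (coef f k).
exists e; first apply/andP; first split.
- by apply: lt_le_trans (bigmax_ge_id _ _ _ _); case/andP: h.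
- by apply/bigmax_ltP; split=> [|k /fm //]; case/andP: h.
move=> k mk; have [/NP kN|/ltW kN] := leP (2^-1) (v (coef f k)).
  exact: (@le_bigmax_cond _ _ _ _ (BMultinom kN)).
exact: le_trans kN (bigmax_ge_id _ _ _ _).
Qed.

(* [D i] lists the exponents that must not occur in the [i]-th quotient. The
   remainder is treated as a quotient too: that of the divisor 1. *)
Variables (I : finType) (g : I -> T).
Variables (l : I -> 'X_{1..n}) (D : I -> pred 'X_{1..n}).
Hypothesis g_monic : forall i, monic_at (g i) (l i).
Hypothesis coverD : forall m, exists i k, ~~ D i k /\ m = (k + l i)%MM.

(** Cancel the largest exponent whose coefficient exceeds [c * e]. This changes higher coefficients
    by at most [c * e], so that exponent descends in the well-founded monomial order. *)
Lemma division_step (e c : R) f :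
  0 < e -> (forall i k, (l i < k)%O -> v (coef (g i) k) <= e) ->
  gauss_le c f -> exists q : I -> T,
    [/\ forall i, gauss_le c (q i), forall i m, D i m -> coef (q i) m = 0
      & gauss_le (c * e) (f - \sum_i q i * g i)].
Proof.
move=> e0 ge fc; have c0 := gauss_le_ge0 fc.
have stop f' : gauss_le (c * e) f' -> exists q : I -> T,
    [/\ forall i, gauss_le c (q i), forall i m, D i m -> coef (q i) m = 0
      & gauss_le (c * e) (f' - \sum_i q i * g i)].
  exists (fun=> 0); split=> // [i|]; first exact: gauss_le0.
  by rewrite big1 ?subr0 // => i _; rewrite mul0r.
(* If [c] is 0 then so is [f], and zero quotients do. Otherwise only finitely many coefficients
   exceed the positive threshold [c * e]. *)
have [cp|cn] := ltP 0 c; last first.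
  by apply: stop; have -> : c = 0 by [apply/le_anti; rewrite cn]; rewrite mul0r
    => m; apply: le_trans (fc m) cn.
have ce0 : 0 < c * e by rewrite mulr_gt0.
have dich f' : gauss_le (c * e) f' \/ exists2 m, c * e < v (coef f' m) &
    forall k, (m < k)%O -> v (coef f' k) <= c * e.
  have [|nb] := pselect (gauss_le (c * e) f'); [by left | right].
  have [m mb] : exists m, c * e < v (coef f' m).
    apply: contrapT => nom; apply: nb => m; rewrite leNgt; apply/negP => mb.
    by apply: nom; exists m.
  have [N NP] := large_coefs_finite f' ce0.
  have [|j jb jmax] := @order_max (fun k => c * e < v (coef f' k)) N m _ mb.
    by move=> k /ltW /NP.
  by exists j => // k /jmax; rewrite -leNgt.
have [/stop //|[m _ mP]] := dich f.
elim/(ltmwf (n := n)): m f fc mP => m IH f fc mP.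
have [i [k [Dk mE]]] := coverD m; have [gl g1 _] := g_monic i.
pose t := coef f m *: tmonomial k.
have tc : gauss_le c t.
  apply: gauss_le_trans (gauss_leZ _ (gauss_le_tmonomial k)).
  by rewrite mulr1; apply: fc.
have tgc : gauss_le c (t * g i) by rewrite -[c]mulr1; apply: gauss_leM.
(* At [m] the coefficient 1 of [g i] cancels; beyond [m], only coefficients of [g i] beyond [l i]
   contribute, each at most [e]. *)
have fP j : (m <= j)%O -> v (coef (f - t * g i) j) <= c * e.
  rewrite le_eqVlt => /predU1P[<-|mj].
    rewrite tcoefB /t [X in coef (_ * _) X]mE tcoefZXM gl mulr1.
    by rewrite subrr absval0 ltW.
  rewrite tcoefB; apply: le_trans (absvalD _ _ _) _; rewrite ge_max mP // andTb.
  rewrite absvalN /t.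
  have [kj|kj] := boolP (k <= j)%MM; last first.
    by rewrite tcoefZXM_eq0 // absval0 ltW.
  rewrite -(submK kj) addmC tcoefZXM absvalM ler_pM ?absval_ge0 ?ge //.
  by rewrite -(ltmc_add2r k) -mE [(k + (j - k))%MM]addmC submK.
have [q [qc qD qe]] : exists q : I -> T,
    [/\ forall i, gauss_le c (q i), forall i m, D i m -> coef (q i) m = 0
      & gauss_le (c * e) (f - t * g i - \sum_i q i * g i)].
  have [/stop //|[m' m'b m'P]] := dich (f - t * g i).
  apply: (IH m') => //; last exact: gauss_leB.
  by rewrite ltNge; apply/negP => /fP; rewrite leNgt m'b.
exists (fun j => q j + (if j == i then t else 0)); split.
- by move=> j; apply: gauss_leD => //; case: eqP => // _; apply: gauss_le0.
(* [t] is supported at [k], an exponent allowed in the [i]-th quotient. *)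
- move=> j j' Dj; rewrite tcoefD qD // add0r; case: eqP Dj => // -> Dj.
  rewrite tcoefZ /=; case: eqP => [E|_]; last by rewrite mulr0.
  by move: Dk; rewrite -E Dj.
have -> // : f - \sum_j (q j + (if j == i then t else 0)) * g j =
    f - t * g i - \sum_j q j * g j.
under eq_bigr do rewrite mulrDl.
rewrite big_split /= opprD addrA addrAC; congr (_ - _ - _).
rewrite (bigD1 i) //= eqxx big1 ?addr0 // => j /negPf ->.
by rewrite mul0r.
Qed.

Hypothesis v_complete : absval_complete v.

(** Each [division_step] shrinks the bound on the remainder by the factor [e], so the successive
    quotients form geometrically convergent series. *)
Lemma division f : exists q : I -> T,
  (forall i m, D i m -> coef (q i) m = 0) /\ f = \sum_i q i * g i.
Proof.
have [e e01 ge] : exists2 e : R, 0 < e < 1 &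
    forall i k, (l i < k)%O -> v (coef (g i) k) <= e.
  have gap i : exists e : R, 0 < e < 1 /\
      forall k, (l i < k)%O -> v (coef (g i) k) <= e.
    by have [e ? ?] := monic_gap (g_monic i); exists e.
  have [d dP] := choice gap.
  exists (\big[Num.max/2^-1]_i d i).
    apply/andP; split; first by apply: lt_le_trans (bigmax_ge_id _ _ _ _); lra.
    apply/bigmax_ltP; split=> [|i _]; first by lra.
    by case: (dP i) => /andP[].
  move=> i k lk; apply: le_trans (le_bigmax _ _ i).
  by case: (dP i) => _; apply.
have [e0 e1] := andP e01; have e01' : 0 <= e < 1 by rewrite ltW.
have [C C0 fC] := gauss_bounded f.
(* [p] pairs a bound with a remainder. Making the bound a premise inside the existential lets
   [choice] produce a total function. *)
have step (p : R * T) : exists q : I -> T, gauss_le p.1 p.2 ->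
    [/\ forall i, gauss_le p.1 (q i), forall i m, D i m -> coef (q i) m = 0
      & gauss_le (p.1 * e) (p.2 - \sum_i q i * g i)].
  have [hc|nhc] := pselect (gauss_le p.1 p.2); last by exists (fun=> 0).
  by have [q qP] := division_step e0 ge hc; exists q.
have [Q QP] := choice step.
pose F := fix F k := if k is j.+1 then
  F j - \sum_i Q (C * e ^+ j, F j) i * g i else f.
pose u i k := Q (C * e ^+ k, F k) i.
have FP k : gauss_le (C * e ^+ k) (F k).
  elim: k => [|k IH]; first by rewrite expr0 mulr1.
  by rewrite exprSr mulrA; have [] := QP (_, _) IH.
have uP i k : gauss_le (C * e ^+ k) (u i k).
  by have [uq _ _] := QP (_, _) (FP k); apply: uq.
have uD i k m : D i m -> coef (u i k) m = 0.
  by have [_ uD _] := QP (_, _) (FP k); apply: uD.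
have [s sP] := choice (fun i => tate_series v_complete e01' (ltW C0) (uP i)).
have FE N : F N = f - \sum_i (\sum_(k < N) u i k) * g i.
  elim: N => [|N IH].
    by rewrite big1 ?subr0 // => i _; rewrite big_ord0 mul0r.
  rewrite /= {1}IH -addrA -opprD -big_split /=; congr (_ - _).
  by apply: eq_bigr => i _; rewrite big_ord_recr /= mulrDl.
exists s; split=> [i m Dm|].
  apply/eqP/negPn/negP => /(absval_gt0 v) sm.
  have [N] := geometric_lt C e01' sm; apply/negP; rewrite -leNgt.
  apply: le_trans (sP i N m); rewrite tcoefB tcoef_sum big1 ?subr0 // => k _.
  exact: uD.
apply/eqP; rewrite -subr_eq0; apply/eqP.
apply: (gauss_le_eq0 (C := C) e01') => N.
have -> : f - \sum_i s i * g i =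
    F N - \sum_i (s i - \sum_(k < N) u i k) * g i.
  rewrite FE -addrA -opprD -big_split /=; congr (_ - _); apply: eq_bigr => i _.
  by rewrite -mulrDl addrC subrK.
apply: gauss_leB => //; apply: gauss_le_sum => [|i _].
  by rewrite mulr_ge0 ?exprn_ge0 // ltW.
by rewrite -[C * _]mulr1; apply: gauss_leM => //; case: (g_monic i).
Qed.

End Division.

(** * Affinoid algebras *)

Section Tate.
Variables (R : realType) (K : fieldType) (v : nonarch_absval R K).
Hypothesis v_complete : absval_complete v.

Lemma tate_noetherian (n : nat) : seq_noetherian (tate v n).
Proof.
move=> x.
(* [P] holds the leading exponents of the ideal generated by all the [x i]. *)
pose P m := exists N f, span x N f /\ monic_at f m.
have [s sP sdiv] := dickson P.
have gen m : exists p : nat * tate v n, m \in s ->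
    span x p.1 p.2 /\ monic_at p.2 m.
  have [/sP[N [f fP]]|_] := boolP (m \in s); first by exists (N, f).
  by exists (0%N, 0).
have [G GP] := choice gen.
pose N := (\max_(m <- s) (G m).1)%N.
(* [None] stands for the remainder, with divisor 1; its exponents may not lie above any element of
   [s]. *)
pose g (i : option (seq_sub s)) := if i is Some m then (G (val m)).2 else 1.
pose l (i : option (seq_sub s)) := if i is Some m then val m else 0%MM.
pose D (i : option (seq_sub s)) (m : 'X_{1..n}) :=
  if i is Some _ then false else has (fun k => (k <= m)%MM) s.
have g_monic i : monic_at (g i) (l i).
  case: i => [[m ms]|] /=; first by case: (GP m ms).
  split=> [||k k0]; [by rewrite tcoef1 eqxx | exact: gauss_le1 |].
  by rewrite tcoef1 gt_eqF // absval0.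
have coverD m : exists i k, ~~ D i k /\ m = (k + l i)%MM.
  have [/hasP[k ks km]|ns] := boolP (has (fun k => (k <= m)%MM) s).
    by exists (Some (SeqSub ks)), (m - k)%MM; rewrite /= submK.
  by exists None, m; split=> //=; rewrite addm0.
have [q [qD xN]] := division g_monic coverD v_complete (x N).
exists N; rewrite -/(span x N (x N)).
have tailP : span x N (\sum_(i | i != None) q i * g i).
  apply: span_sum => -[[m ms]|] //= _; apply: spanM.
  have [Gm _] := GP m ms; apply: spanS Gm.
  exact: (leq_bigmax_seq m ms).
rewrite (bigD1 None) //= mulr1 in xN.
have [q0|qn0] := eqVneq (q None) 0; first by rewrite xN q0 add0r.
have [c [m cm]] := monic_scaling qn0.
(* A nonzero remainder lies in the ideal, so its leading exponent is above an element of [s], where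
   its coefficient has to vanish. *)
have Pm : P m.
  exists N.+1, (c *: q None); split=> //.
  have -> : c *: q None = (c *: 1) * (x N - \sum_(i | i != None) q i * g i).
    by rewrite xN addrK -(@scalerAl K (tate v n)) mul1r.
  apply/spanM/spanD; first exact: span_last.
  by rewrite -mulN1r; apply/spanM/(spanS _ tailP).
have [+ _ _] := cm; rewrite tcoefZ (qD None) ?mulr0 //; last exact: sdiv.
by move/esym/eqP; rewrite oner_eq0.
Qed.

Lemma affinoid_quotient (A : comAlgType K) : affinoid v A ->
  exists n (h : {rmorphism tate v n -> A}), (forall a, exists t, h t = a) /\
    forall c t, h (c *: t) = c *: h t.
Proof.
move=> [n [I [phi [psi phiK psiK]]]].
pose h : {rmorphism tate v n -> A} := phi \o (\pi_{ideal_quot I})%qT.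
exists n, h; split=> [a|c t].
  by exists (repr (psi a)); rewrite /h /= reprK psiK.
rewrite /h /= -linearZ /=; congr (phi _).
(* Scalars act on the quotient as multiplication by the class of [c%:A]. *)
by rewrite -[t in LHS]mul1r (@scalerAl K (tate v n)) rmorphM.
Qed.

(** Nontriviality yields, up to inversion, a nonzero element of absolute value below 1; take a high
    power of it. *)
Lemma small_scalar (C : R) : absval_nontrivial v -> 0 < C ->
  exists2 c, c != 0 & v c * C < 1.
Proof.
move=> [y [/eqP y0 /eqP vy]] C0.
have [z z0 vz] : exists2 z, z != 0 & v z < 1.
  have [yl|yg|yE] := ltgtP (v y) 1; [by exists y | | by rewrite yE eqxx in vy].
  by exists y^-1; rewrite ?invr_eq0 // absvalV invf_lt1 ?absval_gt0.
have z01 : 0 <= v z < 1 by rewrite absval_ge0.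
have [k kC] := geometric_lt C z01 ltr01.
exists (z ^+ k); first exact: expf_neq0.
suff -> : v (z ^+ k) = v z ^+ k by rewrite mulrC.
by elim: k {kC} => [|k IH]; rewrite ?absval1 // !exprS absvalM IH.
Qed.

Lemma absval_natr_le1 (m : nat) : v m%:R <= 1.
Proof.
elim: m => [|m IH]; first by rewrite absval0.
rewrite -natr1; apply: le_trans (absvalD _ _ _) _.
by rewrite ge_max IH absval1 lexx.
Qed.

(** If 2 and 3 both had absolute value below 1, so would [3 - 2 = 1]. *)
Lemma absval_unit_nat : exists2 l : nat, (1 < l)%N & v l%:R = 1.
Proof.
have [v2|v2] := eqVneq (v 2%:R) 1; first by exists 2%N.
exists 3%N => //; apply/le_anti; rewrite absval_natr_le1 /= leNgt.
apply/negP => v3.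
have : v (3%:R - 2%:R) < 1.
  apply: le_lt_trans (absvalD _ _ _) _; rewrite gt_max v3 absvalN /=.
  by rewrite lt_neqAle v2 absval_natr_le1.
by rewrite -natrB // absval1 ltxx.
Qed.

Lemma affinoid_root_chain (A : comAlgType K) (l : nat) (a : A) :
  absval_nontrivial v -> affinoid v A -> v l%:R = 1 ->
  exists c (g : nat -> A),
    [/\ c != 0, g 0%N = 1 + c *: a & forall k, g k.+1 ^+ l = g k].
Proof.
move=> vnt /affinoid_quotient[n [h [hsurj hZ]]] vl.
have [t <-] := hsurj a; have [C C0 tC] := gauss_bounded t.
have [c c0 cC] := small_scalar vnt C0.
(* Roots are extracted within the same ball of radius [q], so the extraction can be repeated
   forever. *)
pose q := v c * C.
have q01 : 0 <= q < 1 by rewrite cC mulr_ge0 ?absval_ge0 ?ltW.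
have nxt (x : tate v n) : exists y, gauss_le q x ->
    gauss_le q y /\ (1 + y) ^+ l = 1 + x.
  have [xq|] := pselect (gauss_le q x); last by exists 0.
  by have [y ? ?] := one_unit_root v_complete vl q01 xq; exists y.
have [Y YP] := choice nxt.
pose y k := iter k Y (c *: t).
have yq k : gauss_le q (y k).
  by elim: k => [|k IH]; [exact: gauss_leZ | case: (YP _ IH)].
exists c, (fun k => h (1 + y k)); split=> //.
  by rewrite rmorphD rmorph1 hZ.
by move=> k; rewrite -rmorphXn; case: (YP _ (yq k)) => _ /= ->.
Qed.

End Tate.

Theorem theorem1p2 (R : realType) (K : fieldType) (v : nonarch_absval R K)
    (v_nontrivial : absval_nontrivial v) (v_complete : absval_complete v)
    (A B : idomainAlgType K)
    (A_affinoid : affinoid v A) (B_affinoid : affinoid v B)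
    (B_normal : normal_domain B)
    (f : {lrmorphism {fraction A} -> {fraction B}}) :
  forall a : A, exists b : B, f a%:F = b%:F.
Proof.
move=> a; have [l l1 vl] := absval_unit_nat v.
have [c [g [c0 g0 gl]]] :=
  affinoid_root_chain v_complete a v_nontrivial A_affinoid vl.
have Bnoeth : seq_noetherian B.
  have [n [h [hsurj _]]] := affinoid_quotient B_affinoid.
  exact: seq_noetherian_surj hsurj (tate_noetherian v_complete (n := n)).
have [b bE] : exists b : B, f (g 0%N)%:F = b%:F.
  apply: (root_chain_integral B_normal (g := fun k => f (g k)%:F)) l1 _ => // k.
  by rewrite -!rmorphXn gl.
have fZ : f (c *: a)%:F = c *: f a%:F.
  rewrite -linearZ /=; congr (f _).
  by rewrite -[a in LHS]mul1r scalerAl rmorphM.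
(* Solve [1 + c f(a) = b] for [f(a)]. *)
exists (c^-1 *: (b - 1)).
have -> : (c^-1 *: (b - 1))%:F = c^-1 *: (b - 1)%:F :> {fraction B}.
  by rewrite -[b - 1 in LHS]mul1r scalerAl rmorphM.
rewrite rmorphB rmorph1 /= -bE g0 !rmorphD /= !rmorph1 addrAC subrr add0r fZ.
by rewrite scalerA mulVf // scale1r.
Qed.
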